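(* Let $S\subseteq\mathbb{R}^n$ and $w\in\big([2,\infty)\cap\mathbb{Z}\big)\cup\{+\infty\}$. If $S$ is $w$-strongly nonconvex, then the MICP rank of $S$ is at least $\lceil\log_2(w)\rceil$. In particular, $S$ is not MICP-R if either $S$ is $\infty$-strongly nonconvex, or $S$ is $w$-strongly nonconvex for all $w\in[2,\infty)\cap\mathbb{Z}$.
   Context: Let $n\in\mathbb{N}=\{1,2,\dots\}$ and $p,d\in\mathbb{Z}_+=\{0,1,2,\dots\}$. A pair $(M,d)$ with $M\subseteq\mathbb{R}^{n+p+d}$ closed and convex induces an MICP formulation of $S\subseteq\mathbb{R}^n$ if for every $x\in\mathbb{R}^n$: $x\in S$ if and only if there exist $y\in\mathbb{R}^p$, $z\in\mathbb{Z}^d$ with $(x,y,z)\in M$. The set $S$ is MICP-R (MICP representable) if such $p,d,M$ exist. The MICP rank of an MICP-R set $S$ is the smallest integer $d$ such that some pair $(M,d)$ with $M$ closed convex (and any $p$) induces an MICP formulation of $S$; if $S$ is not MICP-R, its MICP rank is $\infty$. For $w\in([2,\infty)\cap\mathbb{Z})\cup\{+\infty\}$, a set $S\subseteq\mathbb{R}^n$ is $w$-strongly nonconvex if there is a subset $R\subseteq S$ with $|R|=w$ (infinite if $w=+\infty$) such that $\frac{x+y}{2}\notin S$ for all $x,y\in R$ with $x\ne y$. Convention: $\lceil\log_2(\infty)\rceil=\infty$. *)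

(* Defs.v *)
From mathcomp Require Import all_boot all_order all_algebra.
From mathcomp Require Import all_classical all_reals all_analysis.

Set Implicit Arguments.
Unset Strict Implicit.
Unset Printing Implicit Defensive.

Import Order.TTheory GRing.Theory Num.Theory.
Import numFieldNormedType.Exports.

Local Open Scope classical_set_scope.
Local Open Scope ring_scope.

Definition micp_induces (R : realType) (n p d : nat)
    (M : set 'rV[R]_(n + p + d)) (S : set 'rV[R]_n) : Prop :=
  [/\ closed M, convex_set M &
      forall x : 'rV[R]_n,
        S x <-> exists (y : 'rV[R]_p) (z : 'rV[int]_d),
                  M (row_mx (row_mx x y) (map_mx intr z))].

Definition micp_with (R : realType) (n : nat) (S : set 'rV[R]_n) (d : nat)
    : Prop :=
  exists (p : nat) (M : set 'rV[R]_(n + p + d)), micp_induces M S.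

Definition micp_representable (R : realType) (n : nat) (S : set 'rV[R]_n)
    : Prop :=
  exists d : nat, micp_with S d.

(* Ranks and cardinalities live in [\bar int], i.e. the integers together with
   infinite elements; [-oo] is never a rank. *)
Definition micp_rank (R : realType) (n : nat) (S : set 'rV[R]_n) : \bar int :=
  match pselect (exists d : nat, `[< micp_with S d >]) with
  | left exd => (Posz (ex_minn exd))%:E
  | right _ => +oo%E
  end.

Definition has_cardinal (T : Type) (A : set T) (w : \bar int) : Prop :=
  match w with
  | (Posz k)%:E => (A #= `I_k)%card
  | +oo%E => infinite_set A
  | _ => False
  end.

Definition strongly_nonconvex (R : realType) (n : nat) (w : \bar int)
    (S : set 'rV[R]_n) : Prop :=
  exists A : set 'rV[R]_n,
    [/\ A `<=` S, has_cardinal A w &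
        forall x y : 'rV[R]_n,
          A x -> A y -> x <> y -> ~ S (2^-1 *: (x + y))].

(* [er_map] fixes [+oo], which is the convention for the logarithm of [+oo]. *)
Definition ceil_log2 (R : realType) (w : \bar int) : \bar int :=
  er_map (fun k : int => Num.ceil (ln (k%:~R : R) / ln 2)) w.

(* Main.v *)
Require Import Defs.
From mathcomp Require Import all_boot all_order all_algebra.
From mathcomp Require Import all_classical all_reals all_analysis.
From mathcomp Require Import zify lra.

(** Fix a formulation of [S] by a closed convex set [M] with [d] integer
    variables, and attach to each [x] in [S] an integer vector [z x] that
    witnesses its membership.  When [z x] and [z y] have the same parity in
    every coordinate, [(z x + z y) / 2] is again integral, so the midpoint of
    the two points of [M] above [x] and [y], which lies in [M] by convexity,
    witnesses that [(x + y) / 2] belongs to [S] ([micp_midpoint]).  On a subset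
    of [S] whose pairs of distinct points all have their midpoint outside [S],
    the parity of [z x] therefore determines [x]; as there are [2 ^ d] parity
    vectors, such a subset has at most [2 ^ d] elements ([micp_card_le]).  Both claims of the
    theorem are this bound, read on finite and infinite cardinals
    ([micp_strongly_nonconvex]). *)

Set Implicit Arguments.
Unset Strict Implicit.
Unset Printing Implicit Defensive.

Import Order.TTheory GRing.Theory Num.Theory.

Local Open Scope classical_set_scope.
Local Open Scope ring_scope.

Lemma odd_absz_eq_even_add (a b : int) :
  odd `|a| = odd `|b| -> exists c : int, a + b = 2 * c.
Proof. by move=> ab; exists ((a + b) %/ 2)%Z; lia. Qed.

Lemma convex_set_midpoint (R : realType) (V : lmodType R) (M : set V)
    (u v : V) :
  convex_set M -> M u -> M v -> M (2^-1 *: (u + v)).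
Proof.
move=> Mconv /mem_set Mu /mem_set Mv.
have half_ge0 : 0 <= 2^-1 :> R by lra.
have half_le1 : 2^-1 <= 1 :> R by lra.
have -> : 2^-1 *: (u + v) =
    conv (Itv01 half_ge0 half_le1) (u : convex_lmodType V) v.
  rewrite scalerDr; congr (_ + _ *: _).
  by rewrite /= /unstable.onem; lra.
exact: set_mem (Mconv u v _ Mu Mv).
Qed.

Lemma row_parity_midpoint (R : realType) (d : nat) (z w : 'rV[int]_d) :
  (forall i, odd `|z 0 i| = odd `|w 0 i|) ->
  exists t : 'rV[int]_d,
    2^-1 *: (map_mx intr z + map_mx intr w) = map_mx intr t :> 'rV[R]_d.
Proof.
move=> zw; have /choice[c cE] i := odd_absz_eq_even_add (zw i).
exists (\row_i c i); apply/rowP => i; rewrite !mxE -intrD cE intrM.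
by rewrite mulKf// intr_eq0.
Qed.

Lemma micp_midpoint (R : realType) (n p d : nat) (M : set 'rV[R]_(n + p + d))
    (x x' : 'rV[R]_n) (y y' : 'rV[R]_p) (z z' : 'rV[int]_d) :
  convex_set M -> (forall i, odd `|z 0 i| = odd `|z' 0 i|) ->
  M (row_mx (row_mx x y) (map_mx intr z)) ->
  M (row_mx (row_mx x' y') (map_mx intr z')) ->
  exists (u : 'rV[R]_p) (t : 'rV[int]_d),
    M (row_mx (row_mx (2^-1 *: (x + x')) u) (map_mx intr t)).
Proof.
move=> Mconv /(row_parity_midpoint R)[t tE] Mz Mz'.
exists (2^-1 *: (y + y')), t; rewrite -tE -!scale_row_mx -!add_row_mx.
exact: convex_set_midpoint.
Qed.

(** Pigeonhole on the parity of a chosen integer witness.  The parity vectors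
    are numbered so that the bound compares [A] with an initial segment of
    [nat], the form in which cardinals of sets are measured. *)
Lemma micp_card_le (R : realType) (n d : nat) (S A : set 'rV[R]_n) :
  micp_with S d -> A `<=` S ->
  (forall x y, A x -> A y -> x <> y -> ~ S (2^-1 *: (x + y))) ->
  (A #<= `I_(2 ^ d))%card.
Proof.
move=> [p [M [_ Mconv SE]]] AS Amid.
have /choice[z zP] (x : 'rV[R]_n) : exists z : 'rV[int]_d, S x ->
    exists y : 'rV[R]_p, M (row_mx (row_mx x y) (map_mx intr z)).
  have [/SE[y [z Mz]]|nSx] := pselect (S x); last by exists 0.
  by exists z => _; exists y.
pose parity x : {ffun 'I_d -> bool} := [ffun i => odd `|z x 0 i|].
pose code x : nat := enum_rank (parity x).
have code_inj : {in A &, injective code}.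
  move=> x y /set_mem Ax /set_mem Ay /ord_inj/enum_rank_inj/ffunP xy.
  apply: contrapT => /(Amid x y Ax Ay); apply; apply/SE.
  have [[u Mu] [v Mv]] := (zP x (AS x Ax), zP y (AS y Ay)).
  apply: (micp_midpoint Mconv _ Mu Mv) => i.
  by have := xy i; rewrite !ffunE.
rewrite -(card_le_eql (inj_card_eq code_inj)); apply: subset_card_le.
move=> _ [x _ <-] /=.
apply: leq_trans (ltn_ord (enum_rank (parity x))) _.
by rewrite card_ffun card_bool card_ord.
Qed.

Lemma micp_strongly_nonconvex (R : realType) (n d : nat) (S : set 'rV[R]_n)
    (w : \bar int) :
  micp_with S d -> strongly_nonconvex w S -> (w <= (Posz (2 ^ d))%:E)%E.
Proof.
move=> Sd [A [AS Aw Amid]]; have Ale := micp_card_le Sd AS Amid.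
case: w Aw => [[k|//]|Ainf|//] /=; last first.
  by case: Ainf; apply/finite_set_leP; exists (2 ^ d)%N.
by move=> Ak; move: Ale; rewrite (card_le_eql Ak) card_le_II lee_fin lez_nat.
Qed.

(** Since [d] is an integer, rounding up preserves the bound
    [log2 k <= d]. *)
Lemma ceil_log2_le (R : realType) (k : int) (d : nat) :
  0 < k -> k <= (2 ^ d)%N -> Num.ceil (ln (k%:~R : R) / ln 2) <= d.
Proof.
move=> k_gt0 k_le; rewrite ceil_le_int.
have ln2_gt0 : 0 < ln (2 : R) by rewrite ln_gt0 ?ltr1n.
rewrite ler_pdivrMr// mulr_natl -lnXn// ler_ln ?posrE ?exprn_gt0 ?ltr0z//.
by rewrite -natrX -(ler_int R) in k_le *.
Qed.

Theorem lemma4p1 (R : realType) (n : nat) (n_gt0 : (0 < n)%N)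
    (S : set 'rV[R]_n) :
  (forall w : \bar int, (2%:E <= w)%E ->
     strongly_nonconvex w S -> (ceil_log2 R w <= micp_rank S)%E) /\
  (strongly_nonconvex +oo%E S \/
     (forall w : int, 2 <= w -> strongly_nonconvex w%:E S) ->
   ~ micp_representable S).
Proof.
split=> [w w_ge2 Sw|Snonconvex [d Sd]].
  rewrite /micp_rank; case: pselect => [exd|_]; last exact: leey.
  case: ex_minnP => d /asboolP Sd _.
  have := micp_strongly_nonconvex Sd Sw.
  case: w w_ge2 {Sw} => [k||]//; rewrite !lee_fin => k_ge2.
  by apply: ceil_log2_le; apply: lt_le_trans k_ge2.
case: Snonconvex => [/(micp_strongly_nonconvex Sd)//|Snonconvex].
(* Any finite cardinal above the bound will do; the exponent [d.+1] also makes
   it at least 2. *)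
have /Snonconvex/(micp_strongly_nonconvex Sd) : 2 <= Posz (2 ^ d.+1).
  by rewrite lez_nat expnS leq_pmulr ?expn_gt0.
by rewrite lee_fin lez_nat leq_exp2l// ltnn.
Qed.
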